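(* Let $X\neq\Delta^n$ be a finite, connected, regular CW-complex. Assume that the anti-star cover of $X$ is a $1$-Leray cover, and that the $1$-skeleton of $X$ is a simple graph $G$. Then $$(-1)^{m-1}D_c(G)(-1)=\chi(X)-1,$$ where $m$ is the number of vertices of $X$, $D_c(G)$ is the connected domination polynomial of $G$, and $\chi(X)$ is the Euler characteristic of $X$.
   Context: $\Delta^n$ denotes the standard $n$-simplex (so $X\neq \Delta^n$ means that $X$ is not a standard simplex). The vertices of $X$ are its $0$-cells, and $V(X)$ is the set of vertices. For $S\subseteq V(X)$, the subcomplex of $X$ induced (spanned) by $S$ consists of all cells of $X$ all of whose vertices lie in $S$. For a vertex $v$, $\mathrm{ast}_X(v)$ is the subcomplex induced by $V(X)\setminus\{v\}$, and the anti-star cover is the family $\{\mathrm{ast}_X(v)\}_{v\in V(X)}$. A cover of $X$ is a family of non-empty subcomplexes whose union is $X$; in particular, the hypothesis that the anti-star cover is a $1$-Leray cover includes that the union of the $\mathrm{ast}_X(v)$ is $X$. A CW-complex $Y$ is $d$-Leray if $\widetilde{\mathrm H}_i(Z)=0$ for every induced subcomplex $Z$ of $Y$ and every $i\ge d$ (reduced integral homology). A cover is $d$-Leray if all its elements are $d$-Leray. For a finite connected simple graph $G$, a subset $S\subseteq V(G)$ is dominating if each vertex of $G$ belongs to $S$ or is adjacent to an element of $S$; it is connected if it induces a connected (non-empty) subgraph. The connected domination polynomial is $D_c(G)(t)=\sum_S t^{|S|}\in\mathbb Z[t]$, the sum ranging over all connected dominating sets $S\subseteq V(G)$. *)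

(* Defs.v *)
From HB Require Import structures.
From mathcomp Require Import all_boot all_order all_algebra.
From mathcomp Require Import boolp classical_sets functions reals topology.
From mathcomp Require Import normedtype.

Set Implicit Arguments.
Unset Strict Implicit.
Unset Printing Implicit Defensive.

Import GRing.Theory Num.Theory numFieldNormedType.Exports.
Local Open Scope ring_scope.

(* Euclidean norm, not the library's sup norm on ''rV'. *)
Section Ball.
Variables (R : realType) (n : nat).

Definition sqnorm (x : 'rV[R]_n) : R := \sum_(i < n) x ord0 i ^+ 2.
Definition disk : set 'rV[R]_n := [set x | sqnorm x <= 1]%classic.
Definition open_disk : set 'rV[R]_n := [set x | sqnorm x < 1]%classic.
Definition sphere : set 'rV[R]_n := [set x | sqnorm x = 1]%classic.
End Ball.

(* A finite regular CW structure on the space X, which [cw_hausdorff] makes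
   Hausdorff.  Disks being compact, each characteristic map, continuous and
   injective on its disk, is a homeomorphism onto a closed subset of X; as there
   are finitely many cells, closure-finiteness and the weak topology are
   automatic.  In a regular CW complex the boundary of a cell is not only
   contained in, but equal to, a union of cells of smaller dimension; as is usual
   for regular complexes, [cw_boundary] states it in this form. *)
Record regularCW (R : realType) (X : topologicalType) := RegularCW {
  cell : finType;
  dim : cell -> nat;
  charmap : forall a : cell, 'rV[R]_(dim a) -> X;
  cw_hausdorff : hausdorff_space X;
  cw_continuous : forall a,
    {within @disk R (dim a), continuous (@charmap a)}%classic;
  cw_injective : forall a, {in @disk R (dim a) &, injective (@charmap a)};
  cw_cover : forall x : X, exists a,
    (@charmap a @` @open_disk R (dim a))%classic x;
  cw_disjoint : forall a b x,
    (@charmap a @` @open_disk R (dim a))%classic x ->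
    (@charmap b @` @open_disk R (dim b))%classic x -> a = b;
  cw_boundary : forall a, exists B : {set cell},
    (forall b, b \in B -> (dim b < dim a)%N) /\
    (@charmap a @` @sphere R (dim a) =
       \bigcup_(b in [set` B]) (@charmap b @` @open_disk R (dim b)))%classic
}.

Section CW.
Variables (R : realType) (X : topologicalType) (K : regularCW R X).

Definition open_cell (a : cell K) : set X :=
  (@charmap R X K a @` @open_disk R (dim a))%classic.
Definition closed_cell (a : cell K) : set X :=
  (@charmap R X K a @` @disk R (dim a))%classic.

Definition face (b a : cell K) : bool :=
  `[< (open_cell b `<=` closed_cell a)%classic >].

Definition vertex : finType := {v : cell K | dim v == 0%N}.

Definition vertices (a : cell K) : {set vertex} :=
  [set v : vertex | face (val v) a].

Definition euler_char : int := \sum_(a : cell K) (-1) ^+ dim a.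

(* Subcomplexes are represented by their sets of cells. *)
Definition vertex_set (Y : {set cell K}) : {set vertex} :=
  [set v : vertex | val v \in Y].

Definition induced (Y : {set cell K}) (S : {set vertex}) : {set cell K} :=
  [set a in Y | vertices a \subset S].

Definition antistar (v : vertex) : {set cell K} :=
  induced [set: cell K]%SET [set~ v].

Definition is_cover (I : finType) (F : I -> {set cell K}) : Prop :=
  (forall i, F i != finset.set0) /\
  (\bigcup_(i : I) F i)%SET = [set: cell K]%SET.

Definition edge (a : cell K) : bool := dim a == 1%N.

Definition adj : rel vertex :=
  fun v w => (v != w) && [exists a, edge a && (vertices a == [set v; w])].

(* The 1-skeleton has neither loops nor multiple edges; it is then the graph
   with adjacency relation [adj]. *)
Definition simple_skeleton : Prop :=
  (forall a, edge a -> #|vertices a| = 2%N) /\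
  (forall a b, edge a -> edge b -> vertices a = vertices b -> a = b).

(* The homology of a regular CW complex is that of its cellular chain complex:
   C_i is free on the i-cells, and the boundary of a cell is the sum of its
   facets weighted by incidence numbers.  Systems of incidence numbers (one for
   each choice of orientations of the cells) are those satisfying the following
   conditions, and the homology does not depend on the one chosen; see Massey,
   A Basic Course in Algebraic Topology, IX.7, or Cooke and Finney, Homology of
   Cell Complexes, II.  A subcomplex uses the incidence numbers of K. *)
Record incidence := Incidence {
  inc :> cell K -> cell K -> int;
  inc_facet : forall a b,
    face b a -> dim a = (dim b).+1 -> inc a b = 1 \/ inc a b = -1;
  inc_nonfacet : forall a b,
    ~~ (face b a && (dim a == (dim b).+1)) -> inc a b = 0;
  inc_edge : forall a, edge a -> \sum_(b : cell K) inc a b = 0;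
  inc_square : forall a c, \sum_(b : cell K) inc a b * inc b c = 0
}.

Variable e : incidence.

Definition boundary (c : {ffun cell K -> int}) : {ffun cell K -> int} :=
  [ffun b => \sum_(a : cell K) c a * e a b].

Definition chain (Z : {set cell K}) (i : nat) (c : {ffun cell K -> int}) :=
  forall a, c a != 0 -> a \in Z /\ dim a = i.

(* Reduced cycles: in degree 0 the differential is the augmentation to C_(-1),
   which is the group of integers. *)
Definition cycle (Z : {set cell K}) (i : nat) (c : {ffun cell K -> int}) :=
  chain Z i c /\
  if i is 0%N then \sum_(a : cell K) c a = 0 else boundary c = 0.

Definition reduced_homology_zero (Z : {set cell K}) (i : nat) : Prop :=
  forall c, cycle Z i c -> exists2 c', chain Z i.+1 c' & boundary c' = c.

Definition leray (d : nat) (Y : {set cell K}) : Prop :=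
  forall S : {set vertex}, S \subset vertex_set Y ->
  forall i, (d <= i)%N -> reduced_homology_zero (induced Y S) i.

Definition leray_cover (d : nat) (I : finType) (F : I -> {set cell K}) : Prop :=
  is_cover F /\ forall i, leray d (F i).

End CW.

Definition std_simplex (R : realType) (n : nat) : set 'rV[R]_n.+1 :=
  [set x | (forall i, 0 <= x ord0 i) /\ \sum_(i < n.+1) x ord0 i = 1]%classic.

Definition open_face (R : realType) (n : nat) (F : {set 'I_n.+1}) :
    set 'rV[R]_n.+1 :=
  [set x | std_simplex x /\ forall i, (0 < x ord0 i) = (i \in F)]%classic.

(* Isomorphism of CW complexes with a standard simplex: a homeomorphism (by
   compactness) carrying open faces to open cells. *)
Definition is_simplex (R : realType) (X : topologicalType) (K : regularCW R X)
    : Prop :=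
  exists (n : nat) (h : 'rV[R]_n.+1 -> X),
  [/\ {within @std_simplex R n, continuous h}%classic,
      {in @std_simplex R n &, injective h},
      (h @` @std_simplex R n = [set: X])%classic &
      forall F : {set 'I_n.+1}, F != finset.set0 ->
        exists a : cell K, (h @` @open_face R n F)%classic = open_cell a].

Section ConnectedDomination.
Variables (V : finType) (g : rel V).

Definition dominating (S : {set V}) : bool :=
  [forall v, (v \in S) || [exists w in S, g v w]].

Definition connected_subset (S : {set V}) : bool :=
  (S != finset.set0) &&
  [forall v in S, forall w in S,
     connect [rel x y | [&& x \in S, y \in S & g x y]] v w].

Definition conn_dom_poly : {poly int} :=
  \sum_(S : {set V} | connected_subset S && dominating S) 'X^#|S|.
End ConnectedDomination.

(* Main.v *)
(** For a proper set [T] of vertices the induced subcomplex [X[T]] lies in an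
    anti-star, so its reduced homology vanishes in positive degrees and its Euler
    characteristic is the number [c(T)] of components of [G[T]].  No cell has
    all vertices, so the alternating sum of [chi(X[T])] over all [T] is 0; as
    [c(V) = 1] this gives
    [sum_T (-1)^|T| c(T) = (-1)^(m-1) (chi(X) - 1)].
    Counting pairs (component [C], set [T]) by [C] instead, the sets [T] having
    [C] as a component form an interval of the subset lattice, and only the
    intervals reduced to a point, i.e. the dominating [C], contribute: the left
    side is [D_c(G)(-1)]. *)
Require Import Defs.
From HB Require Import structures.
From mathcomp Require Import all_boot all_order all_algebra.
From mathcomp Require Import boolp classical_sets functions reals topology.
From mathcomp Require Import normedtype ring.
Import Order.TTheory GRing.Theory Num.Theory numFieldNormedType.Exports.
Local Open Scope ring_scope.
Set Implicit Arguments.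
Unset Strict Implicit.
Unset Printing Implicit Defensive.

(** * Components of induced subgraphs *)

(** When [A] differs from [B], toggling a fixed [x] in [B] but not in [A] pairs the sets of the
    interval with opposite signs. *)
Lemma sum_sign_interval (V : finType) (A B : {set V}) : A \subset B ->
  \sum_(T : {set V} | (A \subset T) && (T \subset B)) (-1) ^+ #|T|
    = (A == B)%:R * (-1) ^+ #|A| :> int.
Proof.
move=> sAB; have [eqAB|neqAB] := eqVneq A B.
  rewrite mul1r (big_pred1 A) // => T; rewrite -eqAB /=.
  by rewrite andbC -finset.eqEsubset eq_sym.
have /properP[_ [x xB xA]] : A \proper B by rewrite finset.properEneq neqAB sAB.
rewrite mul0r (bigID (fun T : {set V} => x \in T)) /=.
have -> : \sum_(T : {set V} | (A \subset T) && (T \subset B) && (x \in T))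
      (-1) ^+ #|T| =
    \sum_(T : {set V} | (A \subset T) && (T \subset B) && (x \notin T))
      - (-1) ^+ #|T| :> int.
  rewrite (reindex_onto (fun T => x |: T) (fun T => T :\ x)); last first.
    by move=> T /andP[_ xT]; rewrite finset.setD1K.
  apply: eq_big => T.
    rewrite finset.setU11 andbT finset.subUset finset.sub1set xB /=.
    have [xT|xT] := boolP (x \in T).
      rewrite andbF; apply/negbTE/nandP; right; apply/eqP => eT.
      by move: xT; rewrite -eT !inE eqxx.
    rewrite andbT finset.setU1K // eqxx andbT; congr (_ && _).
    apply/idP/idP => [/fintype.subsetP sAT|/fintype.subset_trans->//];
      last exact: finset.subsetUr.
    apply/fintype.subsetP => y yA; move: (sAT y yA).
    by rewrite !inE => /orP[/eqP eyx|//]; rewrite -eyx yA in xA.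
  move=> /andP[/andP[_ _] /eqP eT].
  have xT : x \notin T by rewrite -eT !inE eqxx.
  by rewrite cardsU1 xT exprS mulN1r.
by rewrite sumrN addNr.
Qed.

Section Components.
Variables (V : finType) (g : rel V).
Hypothesis g_sym : symmetric g.

Definition induced_rel (T : {set V}) : rel V :=
  [rel x y | [&& x \in T, y \in T & g x y]].

Definition components (T : {set V}) : {set {set V}} :=
  [set [set y | connect (induced_rel T) x y] | x in T].

Definition outer_boundary (C : {set V}) : {set V} :=
  [set y | (y \notin C) && [exists x in C, g x y]].

Lemma induced_connect_sym T : connect_sym (induced_rel T).
Proof.
by apply: sym_connect_sym => x y; rewrite /induced_rel /= andbCA g_sym.
Qed.

Lemma induced_closed (T : {set V}) : fingraph.closed (induced_rel T) (mem T).
Proof. by move=> x y /and3P[xT yT _] /=; rewrite xT yT. Qed.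

Lemma induced_mono (S T : {set V}) : S \subset T ->
  subrel (connect (induced_rel S)) (connect (induced_rel T)).
Proof.
move=> /fintype.subsetP sST; apply: connect_sub => x y /and3P[xS yS gxy].
by apply: connect1; rewrite /induced_rel /= !sST.
Qed.

(** Every initial segment of a path from [x] ends in the class of [x], so the path never leaves the
    class. Hence a component is connected by paths inside itself, as [connected_subset] requires. *)
Lemma connect_in_class (T : {set V}) x y : connect (induced_rel T) x y ->
  connect (induced_rel [set z | connect (induced_rel T) x z]) x y.
Proof.
case/connectP => p; elim/last_ind: p y => [|p z IH] y /=.
  by move=> _ ->; apply: connect0.
rewrite rcons_path last_rcons => /andP[pth tz] ->.
apply: connect_trans (IH _ pth erefl) (connect1 _).
have xl : connect (induced_rel T) x (last x p) by apply/connectP; exists p.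
rewrite /induced_rel /= !inE xl (connect_trans xl (connect1 tz)) /=.
by case/and3P: tz.
Qed.

(** That no edge of the graph on [T] leaves [C] means that [T] avoids the outer boundary of [C]. A
    connected [C] with this property is the full class of any of its points. *)
Lemma mem_components (T C : {set V}) :
  (C \in components T) = [&& Defs.connected_subset g C, C \subset T
                          & T \subset ~: outer_boundary C].
Proof.
apply/imsetP/and3P => [[x xT {C}->]|[/andP[C0 Cconn] CT TC]].
  set C := finset _.
  have sCT : C \subset T.
    apply/fintype.subsetP => y; rewrite inE => cxy.
    by have := closed_connect (@induced_closed T) cxy => /= <-.
  split => //.
    apply/andP; split; first by apply/set0Pn; exists x; rewrite inE connect0.
    apply/forall_inP => v vC; apply/forall_inP => w wC.
    have cl u : u \in C -> connect (induced_rel C) x u.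
      by rewrite inE => /connect_in_class.
    apply: connect_trans (cl _ wC).
    by rewrite [connect _ _ _]induced_connect_sym; apply: cl.
  apply/fintype.subsetP => y yT; rewrite !inE negb_and negbK; apply/orP.
  have [cxy|ncxy] := boolP (connect (induced_rel T) x y); first by left.
  right.
  apply/negP => /exists_inP[z]; move=> zC gzy.
  have zT := fintype.subsetP sCT z zC; move: zC; rewrite inE => cxz.
  case/negP: ncxy; apply: connect_trans cxz (connect1 _).
  by rewrite /induced_rel /= yT gzy zT.
case/set0Pn: C0 => x xC; exists x; first exact: (fintype.subsetP CT).
apply/setP => y; rewrite inE; apply/idP/idP => [yC|cxy].
  apply: (induced_mono CT); exact: (forall_inP (forall_inP Cconn x xC) y yC).
have clC : fingraph.closed (induced_rel T) (mem C).
  apply: (intro_closed (@induced_connect_sym T)) => u v /and3P[uT vT guv] uC.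
  have := fintype.subsetP TC v vT; rewrite !inE negb_and negbK => /orP[//|].
  by move=> /negP[]; apply/exists_inP; exists u.
by rewrite -[y \in C](closed_connect clC cxy).
Qed.

(** The complement of the outer boundary consists of [C] and of the vertices outside [C] without a
    neighbour in [C], and the latter are exactly the undominated ones. *)
Lemma dominatingE (C : {set V}) : dominating g C = (C == ~: outer_boundary C).
Proof.
apply/forallP/eqP => [dom|eC v].
  apply/setP => v; rewrite !inE negb_and negbK.
  have [//|vC /=] := boolP (v \in C).
  have := dom v; rewrite (negbTE vC) => /exists_inP[w wC gvw].
  by apply/esym/negbTE; rewrite negbK;
    apply/exists_inP; exists w; rewrite // g_sym.
have [//|vC /=] := boolP (v \in C).
move: vC; rewrite {1}eC !inE negbK => /andP[_ /exists_inP[w wC gwv]].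
by apply/exists_inP; exists w; rewrite // g_sym.
Qed.

(* Exchange the sums over [T] and over its components [C]: the sets [T] having
   [C] as a component form the interval from [C] to the complement of the outer
   boundary of [C], a single point exactly when [C] is dominating. *)
Lemma conn_dom_polyN1 :
  (conn_dom_poly g).[-1] = \sum_(T : {set V}) (-1) ^+ #|T| * #|components T|%:R.
Proof.
rewrite /conn_dom_poly horner_sum.
under eq_bigr do rewrite hornerXn.
under [RHS]eq_bigr do rewrite -[#|components _|]sum1_card natr_sum mulr_sumr
  big_mkcond.
rewrite exchange_big big_mkcondr big_mkcond; apply: eq_bigr => C _ /=.
rewrite -big_mkcond /=.
under eq_bigl do rewrite mem_components.
under eq_bigr do rewrite mulr1.
case: (Defs.connected_subset g C) => /=; last by rewrite big_pred0.
rewrite sum_sign_interval.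
  by rewrite -dominatingE; case: dominating; rewrite ?mul1r ?mul0r.
by apply/fintype.subsetP => y yC; rewrite !inE yC.
Qed.

Lemma card_components_connected (x : V) :
  (forall y, connect g x y) -> #|components finset.setT| = 1%N.
Proof.
move=> cx; apply/eqP/cards1P; exists finset.setT; apply/setP => C.
rewrite inE; apply/imsetP/eqP => [[z _ ->]|->].
  apply/setP => y; rewrite !inE.
  rewrite (eq_connect (e' := g));
    last by move=> u v; rewrite /induced_rel /= !inE.
  apply: connect_trans (cx y).
  by rewrite (sym_connect_sym g_sym).
exists x => //; apply/setP => y; rewrite !inE.
by rewrite (eq_connect (e' := g)) ?cx // => u v; rewrite /induced_rel /= !inE.
Qed.

End Components.

(** * Ranks of the cellular boundary *)

Section CoordinateProjection.
Variables (F : fieldType) (C : finType).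

(** Chains of all degrees are row vectors indexed by all cells. The subspace spanned by the cells of
    [A] is the row space of this diagonal idempotent. *)
Definition coord_proj (A : {set C}) : 'M[F]_#|C| :=
  \matrix_(i, j) ((i == j) && (enum_val i \in A))%:R.

Lemma mul_coord_proj (A : {set C}) m (M : 'M[F]_(#|C|, m)) i j :
  (coord_proj A *m M) i j = (enum_val i \in A)%:R * M i j.
Proof.
rewrite mxE (bigD1 i) //= mxE eqxx big1 ?addr0 // => k ki.
by rewrite mxE eq_sym (negbTE ki) mul0r.
Qed.

Lemma tr_coord_proj A : (coord_proj A)^T = coord_proj A.
Proof. by apply/matrixP => i j; rewrite !mxE eq_sym; case: eqP => // ->. Qed.

Lemma mul_coord_projr (A : {set C}) m (M : 'M[F]_(m, #|C|)) i j :
  (M *m coord_proj A) i j = M i j * (enum_val j \in A)%:R.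
Proof.
by rewrite -[M in LHS]trmxK -tr_coord_proj
  -trmx_mul mxE mul_coord_proj mxE mulrC.
Qed.

Lemma sub_coord_projP (A : {set C}) m (M : 'M[F]_(m, #|C|)) :
  reflect (forall i j, enum_val j \notin A -> M i j = 0) (M <= coord_proj A)%MS.
Proof.
apply: (iffP idP) => [/submxP[N ->] i j jA|MA].
  by rewrite mul_coord_projr (negbTE jA) mulr0.
apply/submxP; exists M; apply/matrixP => i j; rewrite mul_coord_projr.
by case: (boolP (_ \in A)) => [_|/MA->]; rewrite ?mulr1 ?mul0r.
Qed.

(** The projection factors as [S^T *m S], where [S] has [#|A|] rows and [S *m S^T] is the identity;
    this bounds the rank from both sides. *)
Lemma mxrank_coord_proj (A : {set C}) : \rank (coord_proj A) = #|A|.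
Proof.
pose S : 'M[F]_(#|A|, #|C|) := \matrix_(i, j) (enum_val i == enum_val j)%:R.
have eP : coord_proj A = S^T *m S.
  apply/matrixP => i j; rewrite mxE.
  have [iA|iA] := boolP (enum_val i \in A); last first.
    rewrite mxE andbF big1 // => k _; rewrite !mxE.
    case: eqP => [ek|]; rewrite ?mul0r //.
    by case/negP: iA; rewrite -ek; apply: enum_valP.
  rewrite mxE andbT (bigD1 (enum_rank_in iA (enum_val i))) //= !mxE.
  rewrite enum_rankK_in // eqxx mul1r (inj_eq enum_val_inj) big1 ?addr0 // =>
    k kn.
  rewrite !mxE; case: eqP => [ek|]; rewrite ?mul0r //.
  by case/eqP: kn; apply: enum_val_inj; rewrite ek enum_rankK_in.
have eS : S *m S^T = 1%:M.
  apply/matrixP => i j; rewrite !mxE (bigD1 (enum_rank (enum_val i))) //= !mxE.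
  rewrite enum_rankK eqxx mul1r eq_sym (inj_eq enum_val_inj) big1 ?addr0 // =>
    k kn.
  rewrite !mxE; case: eqP => [ek|]; rewrite ?mul0r //.
  by case/eqP: kn; rewrite ek enum_valK.
apply/eqP; rewrite eqn_leq; apply/andP; split.
  by rewrite eP (leq_trans (mxrankM_maxr _ _)) // rank_leq_row.
have -> : #|A| = \rank (S *m coord_proj A *m S^T).
  by rewrite eP mulmxA eS mul1mx eS mxrank1.
by rewrite (leq_trans (mxrankM_maxl _ _)) // mxrankM_maxr.
Qed.

End CoordinateProjection.

Lemma clear_denominators (I : finType) (u : I -> rat) :
  exists2 q : int, q != 0 & exists c : {ffun I -> int},
    forall i, q%:~R * u i = (c i)%:~R.
Proof.
exists (\prod_i denq (u i)); first by apply/prodf_neq0 => i _; apply: denq_neq0.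
exists [ffun i => numq (u i) * \prod_(j | j != i) denq (u j)] => i.
rewrite ffunE (bigD1 i) //= !rmorphM /= mulrAC [X in _ = X * _]numqE.
by rewrite [u i * _]mulrC.
Qed.

(** * Euler characteristic of a complex exact in positive degrees *)

Section ChainComplex.
Variables (C : finType) (d : C -> nat) (D : C -> C -> int) (Z : {set C}).

Definition level i : {set C} := [set a in Z | d a == i].

Hypothesis D_deg : forall a b, D a b != 0 -> d a = (d b).+1.
Hypothesis D_sub : forall a b, D a b != 0 -> a \in Z -> b \in Z.
Hypothesis D_sq : forall a c, \sum_b D a b * D b c = 0.
Hypothesis D_exact : forall i (c : {ffun C -> int}), (0 < i)%N ->
  (forall a, c a != 0 -> a \in level i) -> (forall b, \sum_a c a * D a b = 0) ->
  exists2 c' : {ffun C -> int}, (forall a, c' a != 0 -> a \in level i.+1) &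
    forall b, \sum_a c' a * D a b = c b.

Definition boundary_mx : 'M[rat]_#|C| :=
  \matrix_(i, j) (D (enum_val i) (enum_val j))%:~R.

Lemma boundary_mx_sq : boundary_mx *m boundary_mx = 0.
Proof.
apply/matrixP => i j; rewrite !mxE.
under eq_bigr do rewrite !mxE -rmorphM.
rewrite -rmorph_sum /= -[RHS](@mulr0z rat 1); congr (_%:~R).
by rewrite -[RHS](D_sq (enum_val i) (enum_val j)) [RHS](reindex _ (onW_bij _
  (@enum_val_bij C))).
Qed.

Lemma boundary_mxE (c : {ffun C -> int}) j :
  ((\row_i (c (enum_val i))%:~R : 'rV[rat]_#|C|) *m boundary_mx) ord0 j
    = (\sum_a c a * D a (enum_val j))%:~R.
Proof.
rewrite mxE rmorph_sum /= [RHS](reindex _ (onW_bij _ (@enum_val_bij C))) /=.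
by apply: eq_bigr => i _; rewrite !mxE rmorphM.
Qed.

(** Exactness passes from integral to rational coefficients: a rational cycle is scaled to an
    integral one, bounded there, and the bounding chain is scaled back. *)
Lemma level_exact i : (0 < i)%N ->
  (coord_proj rat (level i) :&: kermx boundary_mx
     :=: coord_proj rat (level i.+1) *m boundary_mx)%MS.
Proof.
move=> i0; apply/eqmxP/andP; split; last first.
  rewrite sub_capmx; apply/andP; split.
    apply/sub_coord_projP => k j jZ; rewrite mul_coord_proj mxE.
    have [kZ|] := boolP (_ \in _); last by rewrite mul0r.
    have [->|D0] := eqVneq (D (enum_val k) (enum_val j)) 0;
      first by rewrite mulr0.
    case/negP: jZ; move: kZ; rewrite !inE => /andP[kZ /eqP dk].
    by rewrite (D_sub D0 kZ) /=; apply/eqP/succn_inj; rewrite -(D_deg D0).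
  by apply/sub_kermxP; rewrite -mulmxA boundary_mx_sq mulmx0.
apply/row_subP => k.
have := row_sub k (coord_proj rat (level i) :&: kermx boundary_mx)%MS.
move: (row k _) => u; rewrite sub_capmx =>
  /andP[/sub_coord_projP uZ /sub_kermxP uD].
(* [c] is the integral cycle [q * u], to which [D_exact] applies. *)
have [q q0 [c cE]] := clear_denominators (fun a => u ord0 (enum_rank a)).
have uE : u = q%:~R^-1 *: (\row_i (c (enum_val i))%:~R : 'rV[rat]_#|C|).
  apply/rowP => j; rewrite !mxE -cE enum_valK mulKf ?intr_eq0 //.
have cZ a : c a != 0 -> a \in level i.
  apply: contraNT => aZ; rewrite -(intr_eq0 rat) -cE uZ ?mulr0 //.
  by rewrite enum_rankK.
have cD b : \sum_a c a * D a b = 0.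
  apply/eqP; rewrite -(intr_eq0 rat) -[b]enum_rankK -boundary_mxE.
  move/eqP: uD; rewrite uE -scalemxAl scaler_eq0 invr_eq0 intr_eq0 (negbTE q0)
    /=.
  by move=> /eqP->; rewrite mxE.
have [c' c'Z c'D] := D_exact i0 cZ cD.
pose w : 'rV[rat]_#|C| := \row_i (c' (enum_val i))%:~R.
have -> : u = (q%:~R^-1 *: w) *m boundary_mx.
  rewrite uE -scalemxAl; congr (_ *: _); apply/rowP => j.
  by rewrite boundary_mxE c'D mxE.
apply: submxMr; apply/sub_coord_projP => k' j jZ; rewrite !mxE.
by rewrite (contraNeq (@c'Z _) jZ) mulr0.
Qed.

(** By exactness and rank-nullity, each positive level has as many cells as the sum of the ranks of
    the boundary maps leaving and entering it. The alternating sum then telescopes. *)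
Lemma euler_poincare :
  \sum_(a in Z) (-1) ^+ d a =
  #|level 0%N|%:R
    - (\rank (coord_proj rat (level 1%N) *m boundary_mx))%:R :> int.
Proof.
pose r i := \rank (coord_proj rat (level i) *m boundary_mx).
have rE i : (0 < i)%N -> #|level i| = (r i + r i.+1)%N.
  move=> i0; rewrite -(mxrank_coord_proj rat) -(mxrank_mul_ker _ boundary_mx).
  by rewrite (level_exact i0).
have partial L : \sum_(i < L.+1) (-1) ^+ i * #|level i|%:R =
    #|level 0%N|%:R - (r 1%N)%:R + (-1) ^+ L * (r L.+1)%:R :> int.
  elim: L => [|L IH]; first by rewrite big_ord1 !mul1r subrK.
  rewrite big_ord_recr IH /= (rE L.+1) // natrD exprS mulN1r mulrDr !mulNr.
  by rewrite addrA addrK.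
(* Above the top dimension the level is empty, so the remainder of the telescoping vanishes. *)
pose L := \max_a d a.
have lvl0 : r L.+1 = 0%N.
  apply/eqP; rewrite -leqn0 (leq_trans (mxrankM_maxl _ _)) //.
  rewrite mxrank_coord_proj leqn0 cards_eq0; apply/eqP/setP => a; rewrite !inE.
  by apply/negbTE/nandP; right; rewrite neq_ltn ltnS leq_bigmax.
have := partial L; rewrite lvl0 mulr0 addr0 -/(r 1%N) => <-.
rewrite (partition_big (fun a => inord (d a) : 'I_L.+1) xpredT) //=.
apply: eq_bigr => i _; rewrite -sum1_card natr_sum mulr_sumr.
apply: eq_big => a; rewrite ?inE.
  by rewrite -val_eqE /= inordK // ltnS leq_bigmax.
by move=> /andP[_ /eqP <-]; rewrite mulr1 inordK // ltnS leq_bigmax.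
Qed.

End ChainComplex.

(** * Rank of the vertex-edge incidence matrix of an induced subgraph *)

Section IncidenceRank.
Variables (V C : finType) (g : rel V) (f : V -> C) (D : C -> C -> int).
Variables (T : {set V}) (E : {set C}).
Hypothesis g_sym : symmetric g.
Hypothesis f_inj : injective f.

(** The boundary of [a] is a nonzero multiple of the difference of its ends; the factor [s] absorbs
    the choice of orientation. *)
Definition joins (a : C) (v w : V) :=
  exists2 s : int, s != 0 &
    forall b, D a b = s * ((b == f v)%:R - (b == f w)%:R).

Hypothesis edge_ends : forall a, a \in E ->
  exists v w, [/\ v \in T, w \in T, g v w & joins a v w].
Hypothesis edge_between : forall v w, v \in T -> w \in T -> g v w ->
  exists2 a, a \in E & joins a v w.

Let M := coord_proj rat E *m boundary_mx D.

Lemma coboundaryE (a : C) v w (phi : C -> rat) : joins a v w ->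
  exists2 s : rat, s != 0 &
    \sum_(j < #|C|) phi (enum_val j) * (D a (enum_val j))%:~R
      = s * (phi (f v) - phi (f w)).
Proof.
move=> [s s0 aD]; exists s%:~R; first by rewrite intr_eq0.
rewrite (reindex _ (onW_bij _ (@enum_rank_bij C))) /=.
under eq_bigr => b _.
  rewrite enum_rankK aD rmorphM rmorphB /= !rmorph_nat mulrCA mulrBr.
  over.
rewrite -mulr_sumr sumrB (bigD1 (f v)) //= eqxx mulr1 big1 ?addr0; last first.
  by move=> b /negbTE->; rewrite mulr0.
rewrite (bigD1 (f w)) //= eqxx mulr1 big1 ?addr0 // => b /negbTE->.
by rewrite mulr0.
Qed.

Lemma mulmx_coboundary m (N : 'M[rat]_(m, #|C|)) i k :
  (N *m M^T) i k = (enum_val k \in E)%:R *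
    \sum_j N i j * (D (enum_val k) (enum_val j))%:~R.
Proof.
rewrite mxE mulr_sumr; apply: eq_bigr => j _.
by rewrite mxE mul_coord_proj mxE mulrCA.
Qed.

(** The rows are the indicator vectors of the components, which will form a basis of the degree 0
    cocycles. *)
Definition component_mx : 'M[rat]_(#|components g T|, #|C|) :=
  \matrix_(i, j) (enum_val j \in f @: (enum_val i : {set V}))%:R.

Lemma component_class (B : {set V}) y : B \in components g T -> y \in B ->
  B = [set z | connect (induced_rel g T) y z].
Proof.
move=> /imsetP[x xT ->]; rewrite inE => cxy; apply/setP => z; rewrite !inE.
by rewrite (same_connect (induced_connect_sym g_sym T) cxy).
Qed.

Lemma component_rep : exists rep : 'I_#|components g T| -> V,
  forall i, rep i \in (enum_val i : {set V}).
Proof.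
have ex (i : 'I_#|components g T|) : exists x, x \in (enum_val i : {set V}).
  by case/imsetP: (enum_valP i) => x _ ->; exists x; rewrite inE connect0.
exact: (fin_all_exists ex).
Qed.

(** Evaluation at one representative of each component is a right inverse, because distinct
    components are disjoint. *)
Lemma component_mx_free : row_free component_mx.
Proof.
have [rep repP] := component_rep.
apply/row_freeP; exists (\matrix_(j, i) (enum_val j == f (rep i))%:R).
apply/matrixP => i i'; rewrite !mxE (bigD1 (enum_rank (f (rep i')))) //= !mxE.
rewrite enum_rankK eqxx mulr1 big1 ?addr0 => [|j jn]; last first.
  rewrite !mxE; case: (eqVneq _ (f (rep i'))) => [ej|]; rewrite ?mulr0 //.
  by case/eqP: jn; rewrite -ej enum_valK.
rewrite mem_imset //; congr (_%:R); congr nat_of_bool.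
apply/idP/eqP => [ri|->]; last exact: repP.
apply: enum_val_inj; rewrite (component_class (enum_valP i) ri).
by rewrite -(component_class (enum_valP i') (repP i')).
Qed.

(** A function on the vertices of [T] has zero coboundary when it agrees at the two ends of every
    edge, that is, when it is constant on each component. *)
Lemma component_mxE :
  (component_mx :=: coord_proj rat (f @: T) :&: kermx M^T)%MS.
Proof.
apply/eqmxP/andP; split.
  rewrite sub_capmx; apply/andP; split.
    apply/sub_coord_projP => i j jT; rewrite mxE.
    case: imsetP => [[v vi ej]|//]; case/imsetP: jT; exists v => //.
    have := enum_valP i; rewrite mem_components // =>
      /and3P[_ /fintype.subsetP sT _].
    exact: sT.
  apply/sub_kermxP/matrixP => i k; rewrite mulmx_coboundary [RHS]mxE.
  have [kE|] := boolP (_ \in E); last by rewrite mul0r.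
  rewrite mul1r; have [v [w [vT wT gvw Dk]]] := edge_ends kE.
  under eq_bigr do rewrite mxE.
  have [s _ ->] := coboundaryE (fun b =>
    (b \in f @: (enum_val i : {set V}))%:R) Dk.
  rewrite !mem_imset //; case/imsetP: (enum_valP i) => x _ ->; rewrite !inE.
  have cvw : connect (induced_rel g T) v w.
    by apply: connect1; rewrite /induced_rel /= vT wT.
  rewrite (same_connect_r (induced_connect_sym g_sym T) cvw).
  by rewrite subrr mulr0.
apply/row_subP => k.
have := row_sub k (coord_proj rat (f @: T) :&: kermx M^T)%MS.
move: (row k _) => u; rewrite sub_capmx =>
  /andP[/sub_coord_projP uT /sub_kermxP uM].
pose phi b := u ord0 (enum_rank b).
have phi_adj v w : v \in T -> w \in T -> g v w -> phi (f v) = phi (f w).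
  move=> vT wT gvw; have [a aE aD] := edge_between vT wT gvw.
  have := congr1 (fun N : 'rV[rat]_#|C| => N ord0 (enum_rank a)) uM.
  rewrite /= mulmx_coboundary enum_rankK aE mul1r mxE.
  have [s s0] := coboundaryE phi aD; rewrite /phi.
  under eq_bigr do rewrite enum_valK.
  move=> -> /eqP; rewrite mulf_eq0 (negbTE s0) /= => /eqP/subr0_eq.
  by [].
have phi_const v w : connect (induced_rel g T) v w -> phi (f v) = phi (f w).
  case/connectP => p; elim: p v => [|z p IH] v /=; first by move=> _ ->.
  by case/andP => /and3P[vT zT gvz] pth ew; rewrite (phi_adj v z) // IH.
have [rep repP] := component_rep.
(* The coefficient of each component is the value of the cocycle at its representative. *)
apply/submxP; exists (\row_i phi (f (rep i))); apply/rowP => j; rewrite mxE.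
have [/imsetP[v vT ej]|jT] := boolP (enum_val j \in f @: T); last first.
  rewrite uT // big1 // => i _; rewrite !mxE.
  case: imsetP => [[v vi ej]|]; rewrite ?mulr0 //.
  case/imsetP: jT; exists v => //.
  have := enum_valP i; rewrite mem_components // =>
    /and3P[_ /fintype.subsetP sT _].
  exact: sT.
have vB : [set z | connect (induced_rel g T) v z] \in components g T.
  by apply/imsetP; exists v.
rewrite (bigD1 (enum_rank_in vB [set z | connect (induced_rel g T) v z])) //=
  !mxE.
rewrite ej mem_imset // enum_rankK_in // inE connect0 mulr1 big1 ?addr0.
  rewrite -(phi_const v) /phi -?ej ?enum_valK //.
  have := repP (enum_rank_in vB [set z | connect (induced_rel g T) v z]).
  by rewrite enum_rankK_in // inE.
move=> i ni; rewrite !mxE ej mem_imset //.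
have [vi|] := boolP (v \in _); last by rewrite mulr0.
by case/eqP: ni; apply: enum_val_inj;
  rewrite enum_rankK_in // (component_class (enum_valP i) vi).
Qed.

(** This is rank-nullity for the coboundary on functions supported on [T], whose kernel has the
    components as a basis. *)
Lemma incidence_rank : (\rank M + #|components g T| = #|T|)%N.
Proof.
rewrite -(card_imset _ f_inj) -(mxrank_coord_proj rat (f @: T)).
rewrite -(mxrank_mul_ker (coord_proj rat (f @: T)) M^T) -component_mxE.
have /eqP-> := component_mx_free; congr (_ + _)%N.
(* After transposition it remains to see that projecting onto the vertices of [T] does not change
   [M]: all edges in [E] have both ends in [T]. *)
rewrite -tr_coord_proj -trmx_mul mxrank_tr; congr (\rank _).
apply/matrixP => i j; rewrite mul_coord_projr.
have [_|jT] := boolP (_ \in _); rewrite ?mulr1 ?mulr0 //.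
rewrite mul_coord_proj mxE; have [iE|] := boolP (_ \in E);
  last by rewrite mul0r.
have [v [w [vT wT _ [s _ ->]]]] := edge_ends iE.
have vj u : u \in T -> (enum_val j == f u) = false.
  by move=> uT; apply: contraNF jT => /eqP->; rewrite imset_f.
by rewrite !vj // subrr mulr0 mulr0.
Qed.

End IncidenceRank.

(** * Topology of regular CW complexes *)

Section Euclidean.
Variables (R : realType) (n : nat).
Implicit Types (x y : 'rV[R]_n) (t : R).
Local Open Scope classical_set_scope.

Lemma sqnorm_continuous : continuous (@sqnorm R n).
Proof.
rewrite /sqnorm; elim: (index_enum _) => [|i s IH] x.
  by under eq_fun do rewrite big_nil; apply: cst_continuous.
under eq_fun do rewrite big_cons.
apply: (@continuousD _ _ _ (fun y : 'rV[R]_n => y ord0 i ^+ 2)); last exact: IH.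
apply: (@continuousM _ _ (fun y : 'rV[R]_n => y ord0 i) (fun y => y ord0 i));
  exact: coord_continuous.
Qed.

Lemma sqnorm_eq0 x : (sqnorm x == 0) = (x == 0).
Proof.
apply/idP/eqP => [|->]; last first.
  by rewrite /sqnorm big1 // => i _; rewrite mxE expr0n.
rewrite psumr_eq0 => [/allP x0|i _]; last exact: sqr_ge0.
apply/rowP => i; apply/eqP; rewrite mxE -sqrf_eq0.
by apply: x0; apply: mem_index_enum.
Qed.

Lemma sqnormZ t x : sqnorm (t *: x) = t ^+ 2 * sqnorm x.
Proof.
by rewrite /sqnorm mulr_sumr; apply: eq_bigr => i _; rewrite mxE exprMn.
Qed.

Lemma coord_sqr_le x i : x ord0 i ^+ 2 <= sqnorm x.
Proof.
by rewrite /sqnorm (bigD1 i) //= lerDl sumr_ge0 // => j _; apply: sqr_ge0.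
Qed.

Lemma sqnorm_level_closed (A : set R) : closed A ->
  closed [set x : 'rV[R]_n | A (sqnorm x)].
Proof.
by move=> clA; apply: preimage_closed => // x _; apply: sqnorm_continuous.
Qed.

Lemma disk_compact : compact (@disk R n).
Proof.
apply: bounded_closed_compact; last exact: sqnorm_level_closed (@closed_le _ 1).
exists 1; split => // M M1 x /= x1; rewrite [leLHS]mx_normrE.
apply/bigmax_leP; split => [|[i j] _ /=]; first exact: le_trans (ltW M1).
apply: le_trans (ltW M1); rewrite ord1 -(ler_sqr _ ler01) ?nnegrE //.
by rewrite expr1n real_normK ?num_real // (le_trans (coord_sqr_le _ _)).
Qed.

Lemma sphere_compact : compact (@sphere R n).
Proof.
apply: subclosed_compact (@disk_compact) _; last first.
  by move=> x; rewrite /sphere /disk /= => ->.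
exact: sqnorm_level_closed (@closed_eq _ 1).
Qed.

Lemma open_disk0 : open_disk (0 : 'rV[R]_n).
Proof.
rewrite /open_disk /=.
by have /eqP-> : sqnorm (0 : 'rV[R]_n) == 0 by rewrite sqnorm_eq0.
Qed.

Lemma disk_split : @disk R n = @open_disk R n `|` @sphere R n.
Proof.
apply/seteqP; split => x; rewrite /disk /open_disk /sphere /=.
  by rewrite le_eqVlt => /orP[/eqP|]; [right|left].
by case=> [/ltW|->].
Qed.

End Euclidean.

Lemma sphere_nonempty (R : realType) n : (0 < n)%N ->
  (@sphere R n !=set0)%classic.
Proof.
case: n => // n _; exists (delta_mx ord0 ord0).
rewrite /sphere /= /sqnorm (bigD1 ord0) //= mxE !eqxx expr1n big1 ?addr0 // =>
  i i0.
by rewrite mxE (negbTE i0) expr0n.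
Qed.

(* Reflecting the pole [N] in the hyperplane orthogonal to [z] is continuous for
   [z != 0].  Along the segment from a vector orthogonal to [N] to [x - N], which
   avoids 0 when [x != N], it gives a path from [N] to [x]. *)
Lemma sphere_connected (R : realType) n : (1 < n)%N -> connected (@sphere R n).
Proof.
case: n => [|[|n]] // _.
pose i1 : 'I_n.+2 := lift ord0 ord0.
pose N : 'rV[R]_n.+2 := delta_mx ord0 ord0.
pose w : 'rV[R]_n.+2 := delta_mx ord0 i1.
have NE : sqnorm N = 1.
  rewrite /sqnorm (bigD1 ord0) //= mxE !eqxx expr1n big1 ?addr0 // => i i0.
  by rewrite mxE (negbTE i0) expr0n.
pose refl (z : 'rV[R]_n.+2) := N - (2 * z ord0 ord0 / sqnorm z) *: z.
have sqnormB (c : R) (z : 'rV[R]_n.+2) :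
    sqnorm (N - c *: z) = 1 - 2 * c * z ord0 ord0 + c ^+ 2 * sqnorm z.
  have Nz : \sum_i N ord0 i * z ord0 i = z ord0 ord0.
    rewrite (bigD1 ord0) //= mxE !eqxx mul1r big1 ?addr0 // => i i0.
    by rewrite mxE (negbTE i0) mul0r.
  rewrite -{1}NE -Nz /sqnorm !mulr_sumr -sumrB -big_split /=.
  apply: eq_bigr => i _.
  have -> : (N - c *: z) ord0 i = N ord0 i - c * z ord0 i by rewrite !mxE.
  ring.
have reflS z : z != 0 -> sqnorm (refl z) = 1.
  by rewrite -sqnorm_eq0 => z0; rewrite sqnormB; field.
have refl_cts (z : 'rV[R]_n.+2) : z != 0 -> {for z, continuous refl}.
  rewrite -sqnorm_eq0 => z0.
  apply: (@continuousB _ _ _ (fun=> N)); first exact: cst_continuous.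
  apply: (@continuousZ _ _ _ _ id); last by move=> ?.
  apply: (@continuousM _ _ (fun y : 'rV[R]_n.+2 => 2 * y ord0 ord0)).
    apply: (@continuousM _ _ (fun=> 2)); first exact: cst_continuous.
    exact: coord_continuous.
  by apply: continuousV => //; apply: sqnorm_continuous.
have SN : sphere N by [].
suff -> : @sphere R n.+2 = connected_component (@sphere R n.+2) N.
  exact: component_connected.
apply/seteqP; split; last exact: connected_component_sub.
move=> x Sx; have [->|xN] := eqVneq x N; first exact: connected_component_refl.
have x0 : x ord0 ord0 != 1.
  apply: contra_neq xN => x0; apply/eqP; rewrite -subr_eq0 -sqnorm_eq0.
  have := sqnormB 1 x; rewrite scale1r x0 Sx => h.
  have -> : x - N = -1 *: (N - x) by rewrite scaleN1r opprB.
  by rewrite sqnormZ h; apply/eqP; ring.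
pose path (t : R) := w + t *: (x - N - w).
have path0 t : path t != 0.
  apply/eqP => /rowP p0; have := p0 ord0; have := p0 i1; rewrite !mxE /=.
  rewrite !subr0 !add0r => h1 /eqP; rewrite mulf_eq0 subr_eq0 (negbTE x0) orbF.
  by move=> /eqP t0; move: h1; rewrite t0 mul0r addr0 => /eqP; rewrite oner_eq0.
apply: (@connected_component_max _ _ ((refl \o path) @` `[0, 1])).
- exists 0; first by rewrite /= in_itv /= lexx ler01.
  rewrite /= /path scale0r addr0 /refl mxE /= mulr0 mul0r scale0r subr0 //.
- by move=> _ [t _ <-]; apply: reflS.
- apply: connected_continuous_connected; first exact: segment_connected.
  apply: continuous_subspaceT => t; apply: continuous_comp;
    last exact: refl_cts.
  apply: (@continuousD _ _ _ (fun=> w)); first exact: cst_continuous.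
  apply: (@continuousZ _ _ _ id (fun=> x - N - w)); first by move=> ?.
  exact: cst_continuous.
- exists 1; first by rewrite /= in_itv /= lexx ler01.
  rewrite /= /path scale1r addrC subrK /refl !mxE !eqxx /=.
  have -> : sqnorm (x - N) = 2 - 2 * x ord0 ord0.
    have := sqnormB 1 x; rewrite scale1r Sx => h.
    have -> : x - N = -1 *: (N - x) by rewrite scaleN1r opprB.
    by rewrite sqnormZ h; ring.
  (* At time 1 the reflection exchanges [N] and [x]: its coefficient is -1, and [N + (x - N)] is
     [x]. *)
  have -> : 2 * (x ord0 ord0 - 1) / (2 - 2 * x ord0 ord0) = -1.
    by field; rewrite -{1}[2]mulr1
      -mulrBr mulf_neq0 ?pnatr_eq0 // subr_eq0 eq_sym.
  by rewrite scaleN1r opprK addrC subrK.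
Qed.

(** * Faces, vertices and connectedness of the 1-skeleton *)

Section CellStructure.
Variables (R : realType) (X : topologicalType) (K : regularCW R X).
Local Open Scope classical_set_scope.
Implicit Types a b c : cell K.

Lemma open_cell_sub a : open_cell a `<=` closed_cell a.
Proof. by move=> _ [x x1 <-]; exists x => //; apply: ltW. Qed.

Lemma open_cell_nonempty a : open_cell a !=set0.
Proof. by exists (@charmap R X K a 0); exists 0 => //; apply: open_disk0. Qed.

Lemma closed_cell_closed a : closed (closed_cell a).
Proof.
apply: (compact_closed (cw_hausdorff K)).
by apply: continuous_compact; [apply: cw_continuous|apply: disk_compact].
Qed.

(** A point [x] of the disk is the limit of the interior points [t *: x] as [t] tends to 1 from
    below. *)
Lemma closed_cell_closure a : closed_cell a `<=` closure (open_cell a).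
Proof.
move=> _ [x x1 <-] B Bx.
have near_x : \forall y \near x,
    @disk R (Defs.dim a) y -> B (@charmap R X K a y).
  by have /subspace_continuousP/(_ x x1) := @cw_continuous _ _ K a; apply.
have scale_cts : t *: x @[t --> (1 : R)] --> x.
  rewrite -[X in _ --> X]scale1r.
  apply: (@continuousZ _ _ _ id (fun=> x)); first by move=> ?.
  exact: cst_continuous.
have near_1 : \forall t \near (1 : R)^'-,
    @disk R (Defs.dim a) (t *: x) -> B (@charmap R X K a (t *: x)).
  exact: (cvg_at_left_filter scale_cts near_x).
have [t [t0 t1 tB]] : exists t : R, [/\ 0 < t, t < 1 &
    @disk R (Defs.dim a) (t *: x) -> B (@charmap R X K a (t *: x))].
  near (1 : R)^'- => t; exists t; split; near: t => //.
    exact: nbhs_left_gt.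
  exact: nbhs_left_lt.
have tx : @open_disk R (Defs.dim a) (t *: x).
  rewrite /open_disk /= sqnormZ.
  have t2 : t ^+ 2 < 1 by rewrite expr_lt1 // ltW.
  by apply: le_lt_trans t2; rewrite ler_piMr // sqr_ge0.
exists (@charmap R X K a (t *: x)); split; first by exists (t *: x).
by apply: tB; apply: ltW.
Unshelve. all: by end_near. Qed.

Lemma closed_cell_split a x : closed_cell a x ->
  open_cell a x \/
  exists2 b, (Defs.dim b < Defs.dim a)%N & open_cell b x /\ face b a.
Proof.
case=> y; rewrite disk_split => -[y1|y1] <-; [by left; exists y|right].
have [B [Bdim Bsph]] := cw_boundary a.
have : (@charmap R X K a @` @sphere R (Defs.dim a)) (@charmap R X K a y)
  by exists y.
rewrite Bsph => -[b bB bx]; exists b; first exact: Bdim.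
split => //; apply/asboolP => z bz.
have : (@charmap R X K a @` @sphere R (Defs.dim a)) z by rewrite Bsph; exists b.
by case=> u u1 <-; exists u => //; rewrite disk_split; right.
Qed.

Lemma face_refl a : face a a.
Proof. by apply/asboolP; apply: open_cell_sub. Qed.

Lemma face_closed_cell b a : face b a -> closed_cell b `<=` closed_cell a.
Proof.
move=> /asboolP ba; apply: subset_trans (@closed_cell_closure b) _.
by rewrite (closure_id (closed_cell a)).1;
  [exact: closureS|exact: closed_cell_closed].
Qed.

Lemma face_trans a b c : face a b -> face b c -> face a c.
Proof.
by move=> /asboolP ab /face_closed_cell bc; apply/asboolP => x /ab/bc.
Qed.

(** A closed cell is a union of open cells, and open cells are disjoint, so an open cell meeting it
    lies in it entirely. *)
Lemma meets_face b a x : open_cell b x -> closed_cell a x -> face b a.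
Proof.
move=> bx /closed_cell_split[ax|[c _ [cx ca]]].
  by rewrite (cw_disjoint bx ax) face_refl.
by rewrite (cw_disjoint bx cx).
Qed.

Lemma face_dim b a : face b a -> b = a \/ (Defs.dim b < Defs.dim a)%N.
Proof.
move=> /asboolP ba; have [x bx] := open_cell_nonempty b.
case: (closed_cell_split (ba _ bx)) => [ax|[c ca [cx _]]].
  by left; apply: cw_disjoint bx ax.
by right; rewrite (cw_disjoint bx cx).
Qed.

Lemma mem_vertices (v : vertex K) a : (v \in vertices a) = face (val v) a.
Proof. by rewrite finset.in_set. Qed.

Lemma vertices_face b a : face b a -> (vertices b \subset vertices a)%SET.
Proof.
move=> ba; apply/fintype.subsetP => v; rewrite !mem_vertices => va.
exact: face_trans va ba.
Qed.

Lemma vertices_vertex (v : vertex K) : vertices (val v) = [set v]%SET.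
Proof.
apply/setP => w; rewrite mem_vertices finset.in_set1;
  apply/idP/eqP => [|->]; last exact: face_refl.
by case/face_dim => [/val_inj//|]; rewrite (eqP (valP v)) ltn0.
Qed.

(** By induction on dimension: the boundary sphere of a cell of positive dimension is nonempty,
    hence contains a smaller cell, whose vertices are inherited. *)
Lemma vertices_neq0 a : vertices a != finset.set0.
Proof.
have [k] := ubnP (Defs.dim a); elim: k a => // k IH a ak.
have [da|da] := posnP (Defs.dim a).
  have a0 : Defs.dim a == 0%N by rewrite da.
  by apply/set0Pn; exists (Sub a a0); rewrite mem_vertices SubK face_refl.
have [y y1] := sphere_nonempty R da.
have [B [Bdim Bsph]] := cw_boundary a.
have : (@charmap R X K a @` @sphere R (Defs.dim a)) (@charmap R X K a y)
  by exists y.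
rewrite Bsph => -[b bB bx].
have ba : face b a.
  by apply: meets_face bx _; exists y => //; rewrite disk_split; right.
have /IH/set0Pn[v vb] : (Defs.dim b < k)%N.
  by rewrite (leq_trans (Bdim _ bB)).
by apply/set0Pn; exists v; apply: (fintype.subsetP (vertices_face ba)).
Qed.

(** The open cell through a common point is a face of both cells and has a vertex. *)
Lemma closed_cells_common_vertex a b : closed_cell a `&` closed_cell b !=set0 ->
  exists2 v, v \in vertices a & v \in vertices b.
Proof.
move=> [x [ax bx]]; have [c cx] := @cw_cover _ _ K x.
have /set0Pn[v vc] := vertices_neq0 c.
by exists v; [move: (meets_face cx ax)|move: (meets_face cx bx)] =>
  /vertices_face/fintype.subsetP; apply.
Qed.

Lemma adj_sym : symmetric (@adj R X K).
Proof.
by move=> v w; rewrite /adj eq_sym; under eq_existsb do rewrite finset.setUC.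
Qed.

(* The closed cells of [B] meeting a given graph component and the others form
   two disjoint closed subsets of the union. *)
Lemma connected_union_vertices (B : {set cell K}) :
  connected (\bigcup_(b in [set` B]) closed_cell b) ->
  (forall b, b \in B ->
    {in vertices b &, forall v w, connect (@adj R X K) v w}) ->
  forall b c v w, b \in B -> c \in B -> v \in vertices b -> w \in vertices c ->
  connect (@adj R X K) v w.
Proof.
move=> conB Bconn b c v w bB cB vb wc.
pose P d := [exists u in vertices d, connect (@adj R X K) v u].
have P_meet d d' : d \in B -> closed_cell d `&` closed_cell d' !=set0 ->
    P d -> P d'.
  move=> dB /closed_cells_common_vertex[u ud ud'] /exists_inP[u' u'd cu'].
  by apply/exists_inP; exists u => //;
    apply: connect_trans cu' (Bconn d _ _ _ _ _).
pose E := \bigcup_(d in [set d | d \in B /\ P d]) closed_cell d.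
pose E' := \bigcup_(d in [set d | d \in B /\ ~~ P d]) closed_cell d.
have closedE (Q : set (cell K)) : closed (\bigcup_(d in Q) closed_cell d).
  apply: closed_bigcup; first exact: cardinality.finite_finset.
  by move=> d _; apply: closed_cell_closed.
have EE : E = \bigcup_(b in [set` B]) closed_cell b.
  apply: conB.
  - have [x bx] := open_cell_nonempty b; exists x; exists b;
      last exact: open_cell_sub.
    by split => //; apply/exists_inP; exists v.
  - exists (~` E'); first by apply: closed_openC; apply: closedE.
    apply/seteqP; split => x.
      move=> [d [dB Pd] dx]; split; first by exists d.
      by move=> [d' [d'B /negP Pd'] d'x]; apply/Pd'/(P_meet d) => //; exists x.
    move=> [[d dB dx] nE']; exists d => //; split => //.
    by apply: contra_notT nE' => nPd; exists d.
  - exists E; first exact: closedE.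
    by apply/seteqP; split => x; [move=> Ex; split => //;
      case: Ex => d [dB _] dx; exists d|case].
have [x cx] := open_cell_nonempty c.
have : E x by rewrite EE; exists c => //; apply: open_cell_sub.
move=> [d [dB Pd] dx].
have /exists_inP[u uc vu] : P c.
  by apply: P_meet Pd => //; exists x; split => //; apply: open_cell_sub.
by apply: connect_trans vu (Bconn c _ _ _ _ _).
Qed.

(** By induction on dimension. Above dimension 1 the boundary sphere is connected and is a union of
    smaller closed cells, so [connected_union_vertices] applies; an edge has just its two ends,
    which are adjacent. *)
Lemma vertices_connected a :
  (forall a, edge a -> #|vertices a| = 2%N) ->
  {in vertices a &, forall v w, connect (@adj R X K) v w}.
Proof.
move=> edge_card.
have [k] := ubnP (Defs.dim a); elim: k a => // k IH a ak v w va wa.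
have [->|vw] := eqVneq v w; first exact: connect0.
case: (ltngtP (Defs.dim a) 1) => [|a2|a1].
- rewrite ltnS leqn0 => a0.
  have := vertices_vertex (Sub a a0 : vertex K); rewrite SubK => ea.
  by move: va wa vw; rewrite ea !inE => /eqP-> /eqP->; rewrite eqxx.
- have [B [Bdim Bsph]] := cw_boundary a.
  have Sclosed : closed (@charmap R X K a @` @sphere R (Defs.dim a)).
    apply: (compact_closed (cw_hausdorff K)); apply: continuous_compact.
      apply: continuous_subspaceW (@cw_continuous _ _ K a).
      by rewrite disk_split => x; right.
    exact: sphere_compact.
  (* The boundary is given as a union of open cells; being closed, it contains their closures
     too. *)
  have SE : @charmap R X K a @` @sphere R (Defs.dim a) =
      \bigcup_(b in [set` B]) closed_cell b.
    apply/seteqP; split => x; rewrite {1}Bsph.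
      by move=> [b bB bx]; exists b => //; apply: open_cell_sub.
    move=> [b bB /closed_cell_closure bx]; rewrite -Bsph.
    move/closure_id: Sclosed => ->; apply: closureS bx.
    by rewrite Bsph => y yb; exists b.
  (* A vertex of [a] lies on the boundary, since the open cell of [a] has positive dimension and is
     disjoint from it. *)
  have in_B (u : vertex K) : u \in vertices a -> val u \in B.
    rewrite mem_vertices => ua; have [x ux] := open_cell_nonempty (val u).
    move/asboolP: (ua) => /(_ x ux) [y]; rewrite disk_split => -[y1|y1] yx.
      have ax : open_cell a x by exists y.
      by move: a2; rewrite -(cw_disjoint ux ax) (eqP (valP u)).
    have : (@charmap R X K a @` @sphere R (Defs.dim a)) x by exists y.
    by rewrite Bsph => -[b bB bx]; rewrite (cw_disjoint ux bx).
  apply: (@connected_union_vertices B) (in_B _ va) (in_B _ wa) _ _.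
  + rewrite -SE; apply: connected_continuous_connected;
      first exact: sphere_connected.
    apply: continuous_subspaceW (@cw_continuous _ _ K a).
    by rewrite disk_split => x; right.
  + by move=> b /Bdim ba; apply: IH; apply: leq_trans ba _.
  + by rewrite vertices_vertex inE.
  + by rewrite vertices_vertex inE.
apply: connect1; rewrite /adj vw; apply/existsP; exists a.
rewrite /edge a1 eqxx eq_sym eqEcard finset.subUset !finset.sub1set va wa /=.
by rewrite edge_card ?cards2 ?vw // /edge a1.
Qed.

Lemma graph_connected (edge_card : forall a, edge a -> #|vertices a| = 2%N) :
  connected [set: X] -> forall v w, connect (@adj R X K) v w.
Proof.
move=> conX v w.
apply: (@connected_union_vertices finset.setT _ _ (val v) (val w)).
- rewrite (_ : \bigcup_(b in _) _ = [set: X]) //; apply/seteqP; split => // x _.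
  have [b bx] := @cw_cover _ _ K x.
  by exists b; [rewrite /= inE|apply: open_cell_sub].
- by move=> b _; apply: vertices_connected edge_card.
- by rewrite inE.
- by rewrite inE.
- by rewrite vertices_vertex inE.
- by rewrite vertices_vertex inE.
Qed.

End CellStructure.

(** * Euler characteristics of induced subcomplexes *)

Section EulerCharacteristic.
Variables (R : realType) (X : topologicalType) (K : regularCW R X).
Variable e : incidence K.

Lemma incidence_face a b : e a b != 0 ->
  face b a /\ Defs.dim a = (Defs.dim b).+1.
Proof.
move=> ab; have [/andP[ba /eqP dab]|nab] := 
  boolP (face b a && (Defs.dim a == (Defs.dim b).+1)).
  by [].
by rewrite inc_nonfacet ?eqxx in ab.
Qed.

(** Only the two ends have a nonzero incidence number with [a]; by [inc_edge] these numbers are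
    opposite, and [inc_facet] makes them units. *)
Lemma edge_joins a v w : edge a -> v != w -> vertices a = [set v; w] ->
  joins (val : vertex K -> cell K) e a v w.
Proof.
move=> a1 vw aE.
have da (u : vertex K) : Defs.dim a = (Defs.dim (val u)).+1
  by rewrite (eqP a1) (eqP (valP u)).
have fv : face (val v) a by rewrite -mem_vertices aE !inE eqxx.
have ew : e a (val w) = - e a (val v).
  apply/eqP; rewrite -addr_eq0 addrC -(inc_edge e a1).
  rewrite [eqbRHS](bigD1 (val v)) //= [in eqbRHS](bigD1 (val w)) /=;
    last by rewrite (inj_eq val_inj) eq_sym.
  rewrite big1 ?addr0 // => b /andP[bv bw]; apply/eqP;
    apply: contraT => /incidence_face[ba db].
  have b0 : Defs.dim b == 0%N by rewrite -eqSS -db.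
  have : (Sub b b0 : vertex K) \in vertices a by rewrite mem_vertices SubK.
  by rewrite aE !inE -!val_eqE SubK (negbTE bv) (negbTE bw).
exists (e a (val v)).
  by case: (inc_facet e fv (da v)) => ->.
move=> b; have [->|bv] := eqVneq b (val v).
  by rewrite (inj_eq val_inj) (negbTE vw) subr0 mulr1.
have [->|bw] := eqVneq b (val w); first by rewrite ew sub0r mulrN1.
rewrite subr0 mulr0; apply/eqP; apply: contraT => /incidence_face[ba db].
have b0 : Defs.dim b == 0%N by rewrite -eqSS -db (eqP a1).
have : (Sub b b0 : vertex K) \in vertices a by rewrite mem_vertices SubK.
by rewrite aE !inE -!val_eqE SubK (negbTE bv) (negbTE bw).
Qed.

Hypothesis skeleton_simple : simple_skeleton K.

(** By [euler_poincare] the left side is the number of vertices in [T] minus the rank of the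
    boundary on edges, and [incidence_rank] evaluates this difference. *)
Lemma acyclic_euler (T : {set vertex K}) :
  (forall i, (0 < i)%N -> reduced_homology_zero e (induced finset.setT T) i) ->
  \sum_(a : cell K | vertices a \subset T) (-1) ^+ Defs.dim a
    = #|components (@adj R X K) T|%:R :> int.
Proof.
move=> acyclic; set Z := induced finset.setT T.
have ZE a : (a \in Z) = (vertices a \subset T)
  by rewrite /Z /induced finset.in_set finset.in_setT.
under eq_bigl do rewrite -ZE.
rewrite (@euler_poincare _ _ e).
- have lvl0 : level (@Defs.dim R X K) Z 0%N = [set val v | v in T].
    apply/setP => a; rewrite finset.in_set ZE;
      apply/andP/imsetP => [[aT a0]|[v vT ->]].
      exists (Sub a a0); last by rewrite SubK.
      by apply: (fintype.subsetP aT); rewrite mem_vertices SubK face_refl.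
    by rewrite vertices_vertex finset.sub1set vT; split=> //; exact: (valP v).
  rewrite lvl0 card_imset; last exact: val_inj.
  rewrite -(@incidence_rank _ _ (@adj R X K) val e T (level (@Defs.dim R X K) Z
    1%N)).
  + by rewrite natrD addrAC subrr add0r.
  + exact: adj_sym.
  + exact: val_inj.
  + move=> a; rewrite finset.in_set ZE => /andP[aT a1].
    have /cards2P[v [w [vw aE]]] : #|vertices a| == 2%N
      by rewrite skeleton_simple.1.
    have inT u : u \in vertices a -> u \in T by apply: (fintype.subsetP aT).
    exists v, w; split; [| | |exact: edge_joins].
    * by apply: inT; rewrite aE !inE eqxx.
    * by apply: inT; rewrite aE !inE eqxx orbT.
    * by rewrite /adj vw; apply/existsP; exists a; rewrite aE eqxx andbT.
  + move=> v w vT wT /andP[vw /existsP[a /andP[a1 /eqP aE]]].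
    exists a; last exact: edge_joins.
    by rewrite finset.in_set ZE -/(edge a) a1 aE finset.subUset !finset.sub1set
      vT wT.
- by move=> a b /incidence_face[].
- move=> a b /incidence_face[/vertices_face ba _]; rewrite !ZE.
  exact: fintype.subset_trans.
- exact: inc_square.
- move=> i c i0 cZ cD; have [|c' c'Z c'D] := acyclic i i0 c.
    split; first by move=> a /cZ; rewrite finset.in_set => /andP[aZ /eqP].
    (* In positive degree the condition for a reduced cycle is the vanishing of the ordinary
       boundary, not of the augmentation. *)
    by case: i i0 {cZ} => // i _; apply/ffunP => b; rewrite !ffunE cD.
  exists c' => [a /c'Z[aZ /eqP ai]|b];
    first by rewrite finset.in_set; apply/andP.
  by rewrite -c'D ffunE.
Qed.

(* No cell has all vertices, so by exchanging sums each cell contributes 0. *)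
Lemma sum_sign_euler : is_cover (@antistar R X K) ->
  \sum_(T : {set vertex K}) (-1) ^+ #|T| *
    \sum_(a : cell K | vertices a \subset T) (-1) ^+ Defs.dim a = 0 :> int.
Proof.
move=> [_ cover].
under eq_bigr do rewrite mulr_sumr big_mkcond.
rewrite exchange_big big1 // => a _ /=; rewrite -big_mkcond -mulr_suml /=.
(* The cover puts [a] into some [antistar v], so [v] is not a vertex of [a]. *)
have aV : (vertices a == finset.setT) = false.
  have : a \in finset.setT by rewrite finset.in_setT.
  rewrite -cover => /finset.bigcupP[v _].
  rewrite finset.in_set => /andP[_ /fintype.subsetP av];
    apply: contraTF isT => /eqP aV.
  by have := av v; rewrite aV !inE eqxx => /(_ isT).
rewrite (eq_bigl (fun T : {set vertex K} =>
  (vertices a \subset T) && (T \subset finset.setT))).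
  by rewrite sum_sign_interval ?finset.subsetT // aV !mul0r.
by move=> T; rewrite finset.subsetT andbT.
Qed.

End EulerCharacteristic.

(** * Evaluation of the alternating sum over vertex sets *)

Theorem theorem1p2 (R : realType) (X : topologicalType) (K : regularCW R X)
    (e : incidence K)
    (X_nonempty : ([set: X] !=set0)%classic)
    (X_connected : connected [set: X]%classic)
    (X_not_simplex : ~ is_simplex K)
    (antistar_leray : leray_cover e 1 (@antistar R X K))
    (skeleton_simple : simple_skeleton K) :
  (-1) ^+ (#|vertex K|.-1) * (conn_dom_poly (@adj R X K)).[-1]
    = euler_char K - 1.
Proof.
have [cover leray1] := antistar_leray.
have [x _] := X_nonempty; have [a _] := @cw_cover _ _ K x.
have /set0Pn[v0 _] := vertices_neq0 a.
have compT : #|components (@adj R X K) finset.setT| = 1%N.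
  apply: card_components_connected; first exact: adj_sym.
  exact: (graph_connected skeleton_simple.1 X_connected v0).
have euler_proper (T : {set vertex K}) : T != finset.setT ->
    \sum_(a : cell K | vertices a \subset T) (-1) ^+ Defs.dim a
      = #|components (@adj R X K) T|%:R :> int.
  move=> TV; apply: (acyclic_euler (e := e)) => // i i0.
  have [v vT] : exists v, v \notin T.
    apply/existsP; rewrite -negb_forall; apply: contra TV => /forallP inT.
    by apply/eqP/setP => u; rewrite inT finset.in_setT.
  (* Since [T] misses [v], the subcomplex induced by [T] is also induced in the anti-star of [v],
     where the Leray property applies. *)
  have Tv : T \subset [set~ v] by apply/fintype.subsetP => u uT;
    rewrite !inE; apply: contraNneq vT => <-.
  have -> : induced finset.setT T = induced (antistar v) T.
    apply/setP => b; rewrite !finset.in_set /=; apply/idP/andP => [bT|[]//].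
    by split=> //; apply: fintype.subset_trans bT Tv.
  apply: leray1 => //; apply/fintype.subsetP => u uT.
  by rewrite !finset.in_set /= vertices_vertex finset.sub1set (fintype.subsetP
    Tv).
(* The full vertex set is split off from both sums: there the Euler characteristic is that of [K]
   and the number of components is 1. The remaining terms of the two sums agree. *)
have := sum_sign_euler cover.
rewrite conn_dom_polyN1; last exact: adj_sym.
rewrite (bigD1 finset.setT) //= [X in _ * X = _](bigD1 finset.setT) //=.
under [X in _ + X = 0 -> _]eq_bigr => T TV do rewrite euler_proper //.
rewrite compT mulr1 cardsT.
have -> : \sum_(a : cell K | vertices a \subset finset.setT) (-1) ^+ Defs.dim a
  = euler_char K.
  by apply: eq_bigl => b; rewrite finset.subsetT.
rewrite [X in X = 0 -> _]addrC => /eqP; rewrite addr_eq0 => /eqP ->.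
(* Positivity makes the truncated predecessor a true [m - 1], so that the signs for [m - 1] and [m]
   multiply to -1. *)
have : (0 < #|vertex K|)%N by apply/card_gt0P; exists v0.
case: #|vertex K| => // m _ /=.
rewrite exprS mulN1r mulNr opprK mulrDr mulrN mulrA -expr2 sqrr_sign mul1r.
by rewrite addrC.
Qed.
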